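(* Let $\mathcal{R}=\mathbb{K}[X_1,\ldots,X_r]$ with $\mathbb{K}$ a field. Let $\mathcal{N}\subset\mathcal{R}^n$ be an $\mathcal{R}$-submodule, let $F\in\mathcal{R}^{m\times n}$, let $\preccurlyeq$ be a monomial order on $\mathcal{R}^m$, and let $P\in\mathcal{R}^{k\times m}$ be a minimal $\preccurlyeq$-Gröbner basis of $\mathrm{Syz}_{\mathcal{N}}(F)$. Let $\varphi_1,\ldots,\varphi_D:\mathcal{R}^n\to\mathbb{K}$ ($D\ge1$) be $\mathbb{K}$-linear functionals, and put $\mathcal{N}_i=\bigcap_{1\le j\le i}\ker(\varphi_j)$. Assume that $\mathcal{N}_i\cap\mathcal{N}$ is an $\mathcal{R}$-module for $1\le i\le D$. Let $G=PF\in\mathcal{R}^{k\times n}$ and let $K=(\mu_1,\ldots,\mu_k)=\mathrm{lm}_{\preccurlyeq}(P)$. Then the divide-and-conquer algorithm $\mathrm{Syzygy\_DaC}(\varphi_1,\ldots,\varphi_D,G,\preccurlyeq,K)$ (defined in the context) outputs $(Q,L)$ such that $QP$ is a minimal $\preccurlyeq$-Gröbner basis of $\mathrm{Syz}_{\mathcal{N}_D\cap\mathcal{N}}(F)$ and $L=\mathrm{lm}_{\preccurlyeq}(QP)$.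
   Context: Elements of $\mathcal{R}^m$ are row vectors; a list of $k$ elements of $\mathcal{R}^m$ is identified with the matrix in $\mathcal{R}^{k\times m}$ having them as rows; $e_i$ is the $i$th coordinate vector. For a submodule $\mathcal{N}\subset\mathcal{R}^n$ and $F\in\mathcal{R}^{m\times n}$, $\mathrm{Syz}_{\mathcal{N}}(F)=\{p\in\mathcal{R}^m\mid pF\in\mathcal{N}\}$. A monomial of $\mathcal{R}^m$ is $\nu e_i$ with $\nu$ a monomial of $\mathcal{R}$. A monomial order on $\mathcal{R}^m$ is a total order $\preccurlyeq$ on its monomials such that $\mu_1\preccurlyeq\mu_2$ implies $\mu_1\preccurlyeq\nu\mu_1\preccurlyeq\nu\mu_2$ for all monomials $\nu$ of $\mathcal{R}$; $\prec$ is the strict version. $\mathrm{lm}_{\preccurlyeq}(p)$ is the largest monomial of $p\in\mathcal{R}^m$; for a matrix $P$, $\mathrm{lm}_{\preccurlyeq}(P)$ is the list of leading monomials of its rows. $P$ with rows in a submodule $\mathcal{M}$ is a $\preccurlyeq$-Gröbner basis of $\mathcal{M}$ if $\langle\mathrm{lm}_{\preccurlyeq}(\mathcal{M})\rangle=\langle\mathrm{lm}_{\preccurlyeq}(P)\rangle$; it is minimal if no leading monomial of a row is divisible by that of another row. Algorithm $\mathrm{Syzygy\_BaseCase}(\varphi,G,\preccurlyeq,K)$. Input: a linear functional $\varphi:\mathcal{R}^n\to\mathbb{K}$, $G\in\mathcal{R}^{k\times n}$ with rows $g_1,\ldots,g_k$, a monomial order $\preccurlyeq$ on $\mathcal{R}^m$,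 and a list $K=(\mu_1,\ldots,\mu_k)$ of monomials of $\mathcal{R}^m$. (1) Set $v_i=\varphi(g_i)$ for $1\le i\le k$. (2) If all $v_i=0$, return $(I_k,K)$. (3) Let $\preccurlyeq_K$ be the monomial order on $\mathcal{R}^k$ for which $\nu_1e_i$ is smaller than $\nu_2e_j$ iff $\nu_1\mu_i\prec\nu_2\mu_j$, or $\nu_1\mu_i=\nu_2\mu_j$ and $i<j$; let $\pi$ be the index with $v_\pi\ne0$ for which $e_\pi$ is minimal for $\preccurlyeq_K$ among $\{e_i\mid v_i\neq0\}$. (4) Let $j_1<\cdots<j_\ell$ be the indices $j\in\{1,\ldots,r\}$ with $X_j\mu_\pi\notin\langle\mu_i, i\ne\pi\rangle$; set $\alpha_{j_s}=\varphi(X_{j_s}g_\pi)/v_\pi$ for $1\le s\le\ell$, and $\lambda_i=-v_i/v_\pi$ for $i\ne\pi$. (5) Return $(Q,L)$ where $Q\in\mathcal{R}^{(k+\ell-1)\times k}$ has rows, in this order, $e_i+\lambda_ie_\pi$ for $1\le i<\pi$; $(X_{j_s}-\alpha_{j_s})e_\pi$ for $1\le s\le\ell$; $e_i+\lambda_ie_\pi$ for $\pi<i\le k$; and $L=(\mu_1,\ldots,\mu_{\pi-1},X_{j_1}\mu_\pi,\ldots,X_{j_\ell}\mu_\pi,\mu_{\pi+1},\ldots,\mu_k)$. Algorithm $\mathrm{Syzygy\_DaC}(\varphi_1,\ldots,\varphi_D,G,\preccurlyeq,K)$, for $G\in\mathcal{R}^{k\times n}$, $\preccurlyeq$ a monomial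 order on $\mathcal{R}^m$, $K$ a list of $k$ monomials of $\mathcal{R}^m$. If $D=1$, return $\mathrm{Syzygy\_BaseCase}(\varphi_1,G,\preccurlyeq,K)$. Otherwise let $(Q_1,L_1)=\mathrm{Syzygy\_DaC}(\varphi_1,\ldots,\varphi_{\lfloor D/2\rfloor},G,\preccurlyeq,K)$, then $(Q_2,L_2)=\mathrm{Syzygy\_DaC}(\varphi_{\lfloor D/2\rfloor+1},\ldots,\varphi_D,Q_1G,\preccurlyeq,L_1)$, and return $(Q_2Q_1,L_2)$. *)

(* Defs.v *)
From HB Require Import structures.
From mathcomp Require Import all_boot all_order all_algebra.
From mathcomp Require Import zify.
From mathcomp Require Import boolp.
From mathcomp Require Import mpoly.

Set Implicit Arguments.
Unset Strict Implicit.
Unset Printing Implicit Defensive.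

Import GRing.Theory.
Local Open Scope ring_scope.

(* Submodules are arbitrary (not necessarily decidable) subsets [V -> Prop]. *)

Definition submodule (R : pzRingType) (V : lmodType R) (N : V -> Prop) : Prop :=
  [/\ N 0, forall u v, N u -> N v -> N (u + v) & forall a v, N v -> N (a *: v)].

Definition generated (R : pzRingType) (V : lmodType R) (S : V -> Prop) (v : V) :
    Prop :=
  forall N : V -> Prop, submodule N -> (forall s, S s -> N s) -> N v.

(* The pair (nu, i) stands for the monomial nu * e_i of R^m. *)
Notation vmon r m := ('X_{1..r} * 'I_m)%type.

Definition vmon_mul (r m : nat) (nu : 'X_{1..r}) (mu : vmon r m) : vmon r m :=
  ((nu + mu.1)%MM, mu.2).

Definition vmon_dvd (r m : nat) (mu1 mu2 : vmon r m) : Prop :=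
  exists nu, vmon_mul nu mu1 = mu2.

Record monomial_order (r m : nat) (le : rel (vmon r m)) : Prop :=
  MonomialOrder {
    monomial_order_refl : reflexive le;
    monomial_order_anti : antisymmetric le;
    monomial_order_trans : transitive le;
    monomial_order_total : total le;
    monomial_order_mul : forall (nu : 'X_{1..r}) (mu1 mu2 : vmon r m),
      le mu1 mu2 ->
      le mu1 (vmon_mul nu mu1) /\ le (vmon_mul nu mu1) (vmon_mul nu mu2)
  }.

Section Algorithm.
Context {K : fieldType} {r : nat}.
Local Notation R := {mpoly K[r]}.

Definition vmon_vec (m : nat) (mu : vmon r m) : 'rV[R]_m :=
  'X_[mu.1] *: delta_mx 0 mu.2.

Definition vsupp (m : nat) (p : 'rV[R]_m) : seq (vmon r m) :=
  [seq (nu, i) | i <- enum 'I_m, nu <- msupp (p 0 i)].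

(* [None] when p = 0, which has no leading monomial. *)
Definition lm (m : nat) (le : rel (vmon r m)) (p : 'rV[R]_m) :
    option (vmon r m) :=
  ohead [seq mu <- vsupp p | all (fun nu => le nu mu) (vsupp p)].

Definition lm_mx (m k : nat) (le : rel (vmon r m)) (P : 'M[R]_(k, m)) :
    k.-tuple (option (vmon r m)) :=
  [tuple lm le (row i P) | i < k].

Definition lm_module (m : nat) (le : rel (vmon r m)) (M : 'rV[R]_m -> Prop) :
    'rV[R]_m -> Prop :=
  generated (fun v => exists p mu,
    [/\ M p, lm le p = Some mu & v = vmon_vec mu]).

Definition lm_rows_module (m k : nat) (le : rel (vmon r m)) (P : 'M[R]_(k, m)) :
    'rV[R]_m -> Prop :=
  generated (fun v => exists i mu, lm le (row i P) = Some mu /\ v = vmon_vec mu).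

(* The rows are required to be nonzero, so that [lm_mx le P] is an actual list
   of k monomials. *)
Definition groebner_basis (m k : nat) (le : rel (vmon r m))
    (M : 'rV[R]_m -> Prop) (P : 'M[R]_(k, m)) : Prop :=
  [/\ forall i, M (row i P), forall i, row i P != 0
    & forall v, lm_module le M v <-> lm_rows_module le P v].

Definition minimal_groebner_basis (m k : nat) (le : rel (vmon r m))
    (M : 'rV[R]_m -> Prop) (P : 'M[R]_(k, m)) : Prop :=
  groebner_basis le M P /\
  forall i j mu mu', i != j ->
    lm le (row i P) = Some mu -> lm le (row j P) = Some mu' -> ~ vmon_dvd mu mu'.

Definition syz (m n : nat) (N : 'rV[R]_n -> Prop) (F : 'M[R]_(m, n)) :
    'rV[R]_m -> Prop :=
  fun p => N (p *m F).

(* K-linearity is spelled out because 'rV[R]_n is canonically a module over R,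
   not over K. *)
Definition functional_linear (n : nat) (phi : 'rV[R]_n -> K) : Prop :=
  forall (c : K) (u v : 'rV[R]_n), phi (c%:MP *: u + v) = c * phi u + phi v.

Definition ker_cap (n D : nat) (phi : D.-tuple ('rV[R]_n -> K)) (i : nat) :
    'rV[R]_n -> Prop :=
  fun p => forall j : 'I_D, (j < i)%N -> tnth phi j p = 0.

(* A list of k' rows in R^k together with a list of k' monomials of R^m. *)
Record syz_out (m k : nat) := SyzOut {
  syz_size : nat;
  syz_mat : 'M[R]_(syz_size, k);
  syz_lms : syz_size.-tuple (vmon r m)
}.

Definition syz_out_of_seq (m k : nat) (s : seq ('rV[R]_k * vmon r m)) :
    syz_out m k :=
  SyzOut (\matrix_(i < size s) (tnth (in_tuple s) i).1)
         (map_tuple snd (in_tuple s)).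

Definition order_lt (m : nat) (le : rel (vmon r m)) : rel (vmon r m) :=
  fun x y => (x != y) && le x y.

Definition induced_lt (m k : nat) (le : rel (vmon r m))
    (mu : k.-tuple (vmon r m)) : rel (vmon r k) :=
  fun x y =>
    let x' := vmon_mul x.1 (tnth mu x.2) in
    let y' := vmon_mul y.1 (tnth mu y.2) in
    order_lt le x' y' || (x' == y') && (x.2 < y.2)%N.

Definition induced_le (m k : nat) (le : rel (vmon r m))
    (mu : k.-tuple (vmon r m)) : rel (vmon r k) :=
  fun x y => (x == y) || induced_lt le mu x y.

Definition syzygy_basecase (m n k : nat) (le : rel (vmon r m))
    (phi : 'rV[R]_n -> K) (G : 'M[R]_(k, n)) (mu : k.-tuple (vmon r m)) :
    syz_out m k :=
  let v i := phi (row i G) in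
  if [pick i | v i != 0] is Some i0 then
    (* i0 only witnesses nonemptiness of the argmin range *)
    let piv := extremum (induced_le le mu) i0 (fun i => v i != 0) (fun i => (0%MM, i)) in
    let shift (j : 'I_r) := vmon_mul U_(j) (tnth mu piv) in
    let others := fun w => exists2 i, i != piv & w = vmon_vec (tnth mu i) in
    let js := [seq j <- enum 'I_r |
                 ~~ asbool (generated others (vmon_vec (shift j)))] in
    let alpha (j : 'I_r) := phi ('X_j *: row piv G) / v piv in
    let lambda i := - v i / v piv in
    let reduced (i : 'I_k) : 'rV[R]_k * vmon r m :=
      (delta_mx 0 i + (lambda i)%:MP *: delta_mx 0 piv, tnth mu i) in
    let shifted (j : 'I_r) : 'rV[R]_k * vmon r m :=
      (('X_j - (alpha j)%:MP) *: delta_mx 0 piv, shift j) in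
    syz_out_of_seq
      ([seq reduced i | i : 'I_k <- enum 'I_k & (i < piv)%N]
         ++ [seq shifted j | j <- js]
         ++ [seq reduced i | i : 'I_k <- enum 'I_k & (piv < i)%N])
  else SyzOut 1%:M mu.

(* Structural recursion on [fuel]; see [syzygy_dac1] and [syzygy_dacE] below for
   the recursive description.  The empty list of functionals is never used. *)
Fixpoint syzygy_dac_rec (m n : nat) (le : rel (vmon r m)) (fuel : nat)
    (phis : seq ('rV[R]_n -> K)) (k : nat) (G : 'M[R]_(k, n))
    (mu : k.-tuple (vmon r m)) : syz_out m k :=
  match fuel, phis with
  | fuel'.+1, _ :: _ :: _ =>
      let h := (size phis)./2 in
      let o1 := syzygy_dac_rec le fuel' (take h phis) G mu in
      let o2 := syzygy_dac_rec le fuel' (drop h phis) (syz_mat o1 *m G)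
                               (syz_lms o1) in
      SyzOut (syz_mat o2 *m syz_mat o1) (syz_lms o2)
  | _, phi :: _ => syzygy_basecase le phi G mu
  | _, [::] => SyzOut 1%:M mu
  end.

Definition syzygy_dac (m n k : nat) (le : rel (vmon r m))
    (phis : seq ('rV[R]_n -> K)) (G : 'M[R]_(k, n))
    (mu : k.-tuple (vmon r m)) : syz_out m k :=
  syzygy_dac_rec le (size phis) phis G mu.

Lemma syzygy_dac_rec_fuel (m n : nat) (le : rel (vmon r m)) (f1 f2 : nat)
    (phis : seq ('rV[R]_n -> K)) (k : nat) (G : 'M[R]_(k, n))
    (mu : k.-tuple (vmon r m)) :
  (size phis <= f1)%N -> (size phis <= f2)%N ->
  syzygy_dac_rec le f1 phis G mu = syzygy_dac_rec le f2 phis G mu.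
Proof.
elim: f1 f2 phis k G mu => [|f1 IH] [|f2] [|a [|b s]] k G mu // h1 h2.
set phis := [:: a, b & s] in h1 h2 *; set h := (size phis)./2.
have ht : (size (take h phis) <= (size s).+1)%N.
  by rewrite size_take_min /h /=; lia.
have hd : (size (drop h phis) <= (size s).+1)%N.
  by rewrite size_drop /h /=; lia.
rewrite -[LHS]/(let o1 := syzygy_dac_rec le f1 (take h phis) G mu in
  let o2 := syzygy_dac_rec le f1 (drop h phis) (syz_mat o1 *m G)
              (syz_lms o1) in
  SyzOut (syz_mat o2 *m syz_mat o1) (syz_lms o2)).
rewrite (IH f2 (take h phis)) ?(leq_trans ht) //=.
by rewrite (IH f2 (drop h phis)) ?(leq_trans hd).
Qed.

Lemma syzygy_dac1 (m n k : nat) (le : rel (vmon r m)) (phi : 'rV[R]_n -> K)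
    (G : 'M[R]_(k, n)) (mu : k.-tuple (vmon r m)) :
  syzygy_dac le [:: phi] G mu = syzygy_basecase le phi G mu.
Proof. by []. Qed.

Lemma syzygy_dacE (m n k : nat) (le : rel (vmon r m))
    (phis : seq ('rV[R]_n -> K)) (G : 'M[R]_(k, n))
    (mu : k.-tuple (vmon r m)) :
  (1 < size phis)%N ->
  syzygy_dac le phis G mu =
    let h := (size phis)./2 in
    let o1 := syzygy_dac le (take h phis) G mu in
    let o2 := syzygy_dac le (drop h phis) (syz_mat o1 *m G) (syz_lms o1) in
    SyzOut (syz_mat o2 *m syz_mat o1) (syz_lms o2).
Proof.
case: phis => [|a [|b s]] // _; rewrite /syzygy_dac.
set phis := [:: a, b & s]; set h := (size phis)./2.
have ht : (size (take h phis) <= (size s).+1)%N.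
  by rewrite size_take_min /h /=; lia.
have hd : (size (drop h phis) <= (size s).+1)%N.
  by rewrite size_drop /h /=; lia.
rewrite -[LHS]/(let o1 := syzygy_dac_rec le (size s).+1 (take h phis) G mu in
  let o2 := syzygy_dac_rec le (size s).+1 (drop h phis) (syz_mat o1 *m G)
              (syz_lms o1) in
  SyzOut (syz_mat o2 *m syz_mat o1) (syz_lms o2)).
cbv beta zeta; rewrite (syzygy_dac_rec_fuel le G mu ht (leqnn _)).
by rewrite (syzygy_dac_rec_fuel le _ _ hd (leqnn _)).
Qed.

End Algorithm.

(* Main.v *)
Require Import Defs.
From mathcomp Require Import all_boot all_order all_algebra.
From mathcomp Require Import zify.
From mathcomp Require Import boolp.
From mathcomp Require Import mpoly.

(* For one functional phi let psi(p) = phi(pF), so that the new syzygy module is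
   M' = M with psi = 0.  If pi is the pivot, every element of M whose monomials
   are all smaller than mu_pi reduces to 0 using only rows on which psi
   vanishes, hence lies in M'.  So mu_pi itself is not a leading monomial of M':
   cancelling it against p_pi would give psi(p_pi) = 0.  A leading monomial of M'
   is thus a multiple of some mu_i with i <> pi, or of some X_j mu_pi.  The
   divide-and-conquer case is an induction, with N replaced by its intersection
   with the kernels already treated; reductions terminate by Dickson's lemma. *)

Set Implicit Arguments.
Unset Strict Implicit.
Unset Printing Implicit Defensive.

Import GRing.Theory.

Local Open Scope ring_scope.

(** * Monotone subsequences of sequences of natural numbers *)

Lemma nondecreasing_subseq (a : nat -> nat) :
  exists h : nat -> nat, {homo h : i j / (i < j)%N} /\
    {homo (a \o h) : i j / (i <= j)%N}.
Proof.
have tail_min n : exists k, (n <= k)%N /\ forall l, (n <= l)%N -> (a k <= a l)%N.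
  have ex : exists v, `[< exists2 k, (n <= k)%N & a k = v >].
    by exists (a n); apply/asboolP; exists n.
  case: (ex_minnP ex) => v /asboolP[k nk <-] vmin; exists k; split=> // l nl.
  by apply: vmin; apply/asboolP; exists l.
have [f fP] := choice tail_min.
(* Each [h n] is a position where [a] is minimal over a tail containing all later [h j], so the
   selected values cannot decrease. *)
pose h := fix h n := if n is n'.+1 then f (h n').+1 else f 0.
have h_ge n : exists2 m, (m <= h n)%N & h n = f m.
  by case: n => [|n] /=; [exists 0%N | exists (h n).+1; rewrite ?(fP _).1].
have hS n : (h n < h n.+1)%N by rewrite /= (fP _).1.
have h_lt : {homo h : i j / (i < j)%N} by apply: homo_ltn => // y x z; apply: ltn_trans.
exists h; split=> // i j; rewrite leq_eqVlt => /orP[/eqP-> //|/h_lt hij] /=.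
have [m mi ->] := h_ge i; apply: (fP m).2.
by rewrite (leq_trans mi) // ltnW.
Qed.

(** The coordinates are treated one at a time: passing to a further subsequence keeps the earlier
    ones monotone. *)
Lemma common_nondecreasing_subseq (I : eqType) (s : seq I) (a : nat -> I -> nat) :
  exists h : nat -> nat, {homo h : i j / (i < j)%N} /\
    {in s, forall c, {homo (fun i => a (h i) c) : i j / (i <= j)%N}}.
Proof.
elim: s => [|c s [h [h_lt h_s]]]; first by exists id; split.
have [g [g_lt g_le]] := nondecreasing_subseq (fun i => a (h i) c).
have g_homo : {homo g : i j / (i <= j)%N}.
  by move=> i j; rewrite leq_eqVlt => /orP[/eqP-> //|/g_lt/ltnW].
exists (h \o g); split=> [i j /g_lt/h_lt //|d].
rewrite inE => /orP[/eqP-> //|ds] i j ij /=.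
exact/h_s/g_homo.
Qed.

(** * Divisibility and orders on monomials of [R^m] *)

Section VectorMonomials.
Context {r m : nat}.
Implicit Types (mu x y : vmon r m) (nu : 'X_{1..r}).

Lemma vmon_mulA nu1 nu2 mu :
  vmon_mul nu1 (vmon_mul nu2 mu) = vmon_mul (nu1 + nu2)%MM mu.
Proof. by rewrite /vmon_mul /= addmA. Qed.

Lemma vmon_mul0 mu : vmon_mul 0%MM mu = mu.
Proof. by rewrite /vmon_mul add0m; case: mu. Qed.

Lemma vmon_mul_injl mu : injective (@vmon_mul r m ^~ mu).
Proof. by move=> a b /(congr1 fst) /addIm. Qed.

Lemma vmon_dvd_mull nu x y : vmon_dvd x y -> vmon_dvd x (vmon_mul nu y).
Proof. by move=> [nu' <-]; exists (nu + nu')%MM; rewrite vmon_mulA. Qed.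

Lemma vmon_dvd_trans x y z : vmon_dvd x y -> vmon_dvd y z -> vmon_dvd x z.
Proof. by move=> xy [nu <-]; apply: vmon_dvd_mull. Qed.

Lemma vmon_dvd_refl x : vmon_dvd x x.
Proof. by exists 0%MM; rewrite vmon_mul0. Qed.

Lemma dickson (u : nat -> vmon r m) :
  exists i j, (i < j)%N /\ vmon_dvd (u i) (u j).
Proof.
(* Recording both the component [c] and [m - c] forces [c] to be constant along
   a subsequence on which all coordinates are nondecreasing. *)
pose a n (c : 'I_r + bool) := match c with
  | inl i => (u n).1 i
  | inr true => nat_of_ord (u n).2
  | inr false => (m - (u n).2)%N end.
have [h [h_lt h_le]] :=
  common_nondecreasing_subseq (enum (('I_r + bool)%type : finType)) a.
exists (h 0%N), (h 1%N); split; first exact: h_lt.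
have le01 c : (a (h 0%N) c <= a (h 1%N) c)%N.
  by apply: (h_le c _ 0%N 1%N); rewrite ?mem_enum.
exists ((u (h 1%N)).1 - (u (h 0%N)).1)%MM.
rewrite /vmon_mul submK; last by apply/mnm_lepP => i; apply: (le01 (inl i)).
have := le01 (inr true); have := le01 (inr false); rewrite /a.
case: (u (h 0%N)) (u (h 1%N)) => [a0 i0] [a1 i1] /= l1 l2.
congr pair; apply: val_inj => /=; have := ltn_ord i0; have := ltn_ord i1; lia.
Qed.

Section Order.
Context (le : rel (vmon r m)) (leM : monomial_order le).

Let le_refl := monomial_order_refl leM.
Let le_trans := monomial_order_trans leM.

Lemma le_eq x y : le x y -> le y x -> x = y.
Proof. by move=> xy yx; apply: (monomial_order_anti leM); rewrite xy. Qed.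

Lemma order_ltN x y : order_lt le x y = ~~ le y x.
Proof.
rewrite /order_lt; have := monomial_order_total leM x y.
case: eqP => [->|xy]; first by rewrite le_refl.
by case xy': (le x y); case yx: (le y x) => // _; case: xy; apply: le_eq.
Qed.

Lemma order_ltW x y : order_lt le x y -> le x y.
Proof. by case/andP. Qed.

Lemma order_le_lt_trans y x z : le x y -> order_lt le y z -> order_lt le x z.
Proof.
by move=> xy; rewrite !order_ltN; apply: contraNN => zx; apply: le_trans xy.
Qed.

Lemma order_lt_trans y x z :
  order_lt le x y -> order_lt le y z -> order_lt le x z.
Proof. by move/order_ltW; apply: order_le_lt_trans. Qed.

Lemma order_le_dvd x y : vmon_dvd x y -> le x y.
Proof. by case=> nu <-; have [] := monomial_order_mul leM nu (le_refl x). Qed.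

Lemma order_le_mul nu x y : le x y -> le (vmon_mul nu x) (vmon_mul nu y).
Proof. by move=> xy; have [] := monomial_order_mul leM nu xy. Qed.

(** From a non-accessible monomial, choice builds an infinite strictly descending sequence. By
    Dickson's lemma an earlier term divides a later one, hence is below it for [le], against the
    descent. *)
Lemma order_lt_wf : well_founded (order_lt le).
Proof.
move=> x0; apply: contrapT => nacc.
(* Non-accessibility sits under the existential so that [choice] yields a total function. *)
have next (x : vmon r m) :
    exists y, ~ Acc (order_lt le) x -> ~ Acc (order_lt le) y /\ order_lt le y x.
  have [ax|nax] := pselect (Acc (order_lt le) x); first by exists x.
  apply: contrapT => nex; apply: nax; split=> y yx.
  by apply: contrapT => nay; apply: nex; exists y.
have [f fP] := choice next.
pose u n := iter n f x0.
have u_nacc n : ~ Acc (order_lt le) (u n).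
  by elim: n => [//|n /fP[]].
have u_lt i j : (i < j)%N -> order_lt le (u j) (u i).
  move: i j; apply: (homo_ltn (r := fun x y => order_lt le y x)).
    by move=> y x z /[swap]; apply: order_lt_trans.
  move=> i.
  by have [] := fP _ (u_nacc i).
have [i [j [/u_lt]]] := dickson u.
by rewrite order_ltN => /negP nle /order_le_dvd.
Qed.

Lemma seq_max (s : seq (vmon r m)) : s != [::] ->
  exists2 x, x \in s & {in s, forall y, le y x}.
Proof.
elim: s => [//|x s IH] _; have [s0|/IH[y ys ymax]] := eqVneq s [::].
  by exists x; rewrite s0 ?mem_head // => y; rewrite inE => /eqP->.
have [xy|yx] := orP (monomial_order_total leM x y).
  by exists y; rewrite ?inE ?ys ?orbT // => z /orP[/eqP->|/ymax].
exists x; first exact: mem_head.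
move=> z; rewrite inE => /orP[/eqP-> //|/ymax zy].
exact: le_trans zy yx.
Qed.

(** * The order induced on monomials of [R^k], which selects the pivot *)

Section Induced.
Context (k : nat) (mu : k.-tuple (vmon r m)).

Lemma induced_lt_trans : transitive (induced_lt le mu).
Proof.
move=> y x z; rewrite /induced_lt.
move=> /orP[xy|/andP[/eqP-> xy]] /orP[yz|/andP[/eqP<- yz]].
- by rewrite (order_lt_trans xy yz).
- by rewrite xy.
- by rewrite yz.
- by rewrite eqxx (ltn_trans xy yz) orbT.
Qed.

Lemma induced_le_trans : transitive (induced_le le mu).
Proof.
move=> y x z /orP[/eqP-> //|xy] /orP[/eqP<-|yz]; first by rewrite /induced_le xy orbT.
by rewrite /induced_le (induced_lt_trans xy yz) orbT.
Qed.

(** When the images coincide the indices decide; if these coincide as well, cancelling the common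
    monomial of [mu] makes the two arguments equal. *)
Lemma induced_le_total : total (induced_le le mu).
Proof.
move=> x y; rewrite /induced_le /induced_lt /order_lt [y == x]eq_sym.
rewrite [vmon_mul y.1 _ == _]eq_sym.
case: (eqVneq x y) => //= nxy; case: eqVneq => /= [e|_]; last first.
  by have := monomial_order_total leM (vmon_mul x.1 (tnth mu x.2))
       (vmon_mul y.1 (tnth mu y.2)) => /orP[]->; rewrite ?orbT.
case: ltngtP => //= e2; move: nxy; case: x y e e2 => [a i] [b j] /= e /val_inj ij.
by move: e; rewrite ij => /vmon_mul_injl->; rewrite eqxx.
Qed.

End Induced.
End Order.
End VectorMonomials.

(** * Coefficients, supports and submodules generated by monomials *)

Section LeadingMonomials.
Context {K : fieldType} {r : nat}.
Local Notation R := {mpoly K[r]}.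

Section Support.
Context {m : nat}.
Implicit Types (p q : 'rV[R]_m) (x y mu : vmon r m).

Definition vcoef p mu : K := (p 0 mu.2)@_mu.1.

Lemma mem_vsupp p mu : (mu \in vsupp p) = (vcoef p mu != 0).
Proof.
rewrite /vcoef -mcoeff_msupp; case: mu => nu i /=.
apply/allpairsPdep/idP => [[j [nu' [_ nu'p [-> ->]]]] //|nup].
by exists i, nu; rewrite mem_enum.
Qed.

Lemma vcoefD p q mu : vcoef (p + q) mu = vcoef p mu + vcoef q mu.
Proof. by rewrite /vcoef mxE mcoeffD. Qed.

Lemma vcoefCZ c p mu : vcoef (c%:MP *: p) mu = c * vcoef p mu.
Proof. by rewrite /vcoef mxE mcoeffCM. Qed.

Lemma vcoefXZ nu p mu : vcoef ('X_[nu] *: p) (vmon_mul nu mu) = vcoef p mu.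
Proof. by rewrite /vcoef mxE mulrC /= mcoeffMX. Qed.

Lemma vsuppD p q mu : mu \in vsupp (p + q) -> mu \in vsupp p \/ mu \in vsupp q.
Proof.
rewrite !mem_vsupp vcoefD; have [->|] := eqVneq (vcoef p mu) 0; last by left.
by rewrite add0r; right.
Qed.

Lemma vsuppCZ c p : {subset vsupp (c%:MP *: p) <= vsupp p}.
Proof. by move=> mu; rewrite !mem_vsupp vcoefCZ mulf_eq0 negb_or => /andP[]. Qed.

Lemma vsuppZ a p mu : mu \in vsupp (a *: p) ->
  exists nu y, [/\ nu \in msupp a, y \in vsupp p & mu = vmon_mul nu y].
Proof.
rewrite mem_vsupp /vcoef mxE -mcoeff_msupp => /msuppM_le/allpairsP.
case=> -[nu nu'] [/= nua nu'p e]; exists nu, (nu', mu.2).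
split=> //; first by rewrite mem_vsupp /vcoef -mcoeff_msupp.
by rewrite /vmon_mul /= -e -surjective_pairing.
Qed.

Lemma vsuppXZ nu p mu : mu \in vsupp ('X_[nu] *: p) ->
  exists2 y, y \in vsupp p & mu = vmon_mul nu y.
Proof.
by move=> /vsuppZ[nu' [y [+ yp ->]]]; rewrite msuppX inE => /eqP->; exists y.
Qed.

Lemma mem_vsupp_vmon_vec x mu : (x \in vsupp (vmon_vec mu : 'rV[R]_m)) = (x == mu).
Proof.
rewrite mem_vsupp /vcoef !mxE eqxx /=; case: x mu => [a i] [b j] /=.
rewrite xpair_eqE;case: (i == j); last by rewrite andbF mulr0 mcoeff0 eqxx.
by rewrite mulr1 mcoeffX [b == a]eq_sym andbT; case: (a == b); rewrite ?oner_eq0 ?eqxx.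
Qed.

Lemma vmon_vec_mul nu mu :
  vmon_vec (vmon_mul nu mu) = 'X_[nu] *: vmon_vec mu :> 'rV[R]_m.
Proof. by rewrite /vmon_vec scalerA -mpolyXD. Qed.

(** [generated] is an intersection of submodules, so it is tested on one of them: the vectors all of
    whose monomials are divisible by some [mu i] with [A i]. *)
Lemma vmon_vec_generated (I : Type) (A : I -> Prop) (mu : I -> vmon r m) x :
  generated (fun v : 'rV[R]_m => exists2 i, A i & v = vmon_vec (mu i)) (vmon_vec x) <->
  exists2 i, A i & vmon_dvd (mu i) x.
Proof.
split=> [gen|[i Ai [nu <-]] N [_ _ NZ] NS]; last first.
  by rewrite vmon_vec_mul; apply/NZ/NS; exists i.
have := gen (fun v => forall y, y \in vsupp v -> exists2 i, A i & vmon_dvd (mu i) y).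
apply=> [|v [i Ai ->] y|]; last by rewrite mem_vsupp_vmon_vec.
  split=> [y|u v Nu Nv y /vsuppD[/Nu|/Nv] //|a v Nv y].
    by rewrite mem_vsupp /vcoef mxE mcoeff0 eqxx.
  move=> /vsuppZ[nu [z [_ /Nv[i Ai iz] ->]]].
  by exists i => //; apply: vmon_dvd_mull.
by rewrite mem_vsupp_vmon_vec => /eqP->; exists i => //; apply: vmon_dvd_refl.
Qed.

End Support.

(** * Leading monomials, minimal Gröbner bases and division *)

Section Order.
Context {m : nat} (le : rel (vmon r m)) (leM : monomial_order le).
Implicit Types (p q : 'rV[R]_m) (mu : vmon r m).

(** The head of the filtered list is well determined because antisymmetry leaves at most one maximal
    monomial. *)
Lemma lmP p mu : lm le p = Some mu <->
  mu \in vsupp p /\ {in vsupp p, forall x, le x mu}.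
Proof.
rewrite /lm; set s := [seq _ <- _ | _].
have sE x : (x \in s) = (x \in vsupp p) && all (fun y => le y x) (vsupp p).
  by rewrite mem_filter andbC.
split=> [|[mup mumax]].
  case: s sE => //= x s sE [<-]; have := sE x; rewrite mem_head => /esym/andP[-> /allP].
  by [].
have : mu \in s by rewrite sE mup; apply/allP.
case: s sE => //= x s sE _; have := sE x; rewrite mem_head => /esym/andP[xp /allP xmax].
by congr Some; apply: (le_eq leM); [apply: mumax | apply: xmax].
Qed.

Lemma lm_neq0 p mu : lm le p = Some mu -> p != 0.
Proof.
move=> /lmP[+ _]; apply: contraTneq => ->.
by rewrite mem_vsupp /vcoef mxE mcoeff0 eqxx.
Qed.

Lemma vsupp_nil p : vsupp p = [::] -> p = 0.
Proof.
move=> p0; apply/rowP => i; rewrite mxE; apply/mpolyP => nu; rewrite mcoeff0.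
by apply/eqP; have := mem_vsupp p (nu, i); rewrite p0 in_nil => /esym/negbFE.
Qed.

Lemma lm_exists p : p != 0 -> exists mu, lm le p = Some mu.
Proof.
move=> p0; have [|mu mup mumax] := @seq_max _ _ _ leM (vsupp p).
  by apply: contra_neq p0; apply: vsupp_nil.
by exists mu; apply/lmP.
Qed.

Lemma lmXZ nu p mu :
  lm le p = Some mu -> lm le ('X_[nu] *: p) = Some (vmon_mul nu mu).
Proof.
move=> /lmP[mup mumax]; apply/lmP; split; first by rewrite mem_vsupp vcoefXZ -mem_vsupp.
by move=> _ /vsuppXZ[x /mumax xmu ->]; apply: order_le_mul.
Qed.

Lemma lm_addl p q mu : lm le p = Some mu ->
  {in vsupp q, forall x, order_lt le x mu} -> lm le (p + q) = Some mu.
Proof.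
move=> /lmP[mup mumax] qmu; apply/lmP; split; last first.
  by move=> x /vsuppD[/mumax //|/qmu/order_ltW].
have /negbTE muq : mu \notin vsupp q by apply/negP => /qmu; rewrite /order_lt eqxx.
by move: muq mup; rewrite !mem_vsupp vcoefD => /negbFE/eqP->; rewrite addr0.
Qed.

Lemma lm_cancel p q nu mu : lm le p = Some (vmon_mul nu mu) -> lm le q = Some mu ->
  exists c : K, {in vsupp (p + c%:MP *: ('X_[nu] *: q)),
    forall x, order_lt le x (vmon_mul nu mu)}.
Proof.
move=> /lmP[_ pmax] /(lmXZ nu)/lmP[]; set q' := _ *: q; set mu' := vmon_mul nu mu.
rewrite mem_vsupp => q'mu q'max.
(* Minus the quotient of the two leading coefficients, which cancels the common leading monomial. *)
exists (- (vcoef p mu' / vcoef q' mu')) => x xpq; apply/andP; split; last first.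
  by case/vsuppD: xpq => [/pmax|/vsuppCZ/q'max].
apply: contraTneq xpq => ->; rewrite mem_vsupp negbK vcoefD vcoefCZ.
by rewrite mulNr divfK ?subrr.
Qed.

(** Divisibility form of a minimal Gröbner basis, with its leading monomials [mu] as data: this is
    the invariant carried through both algorithms. *)
Record minimal_lm_basis (M : 'rV[R]_m -> Prop) k (P : 'M[R]_(k, m))
    (mu : 'I_k -> vmon r m) : Prop := MinimalLmBasis {
  mlb_mem : forall i, M (row i P);
  mlb_lm : forall i, lm le (row i P) = Some (mu i);
  mlb_cover : forall p x, M p -> lm le p = Some x -> exists i, vmon_dvd (mu i) x;
  mlb_ndvd : forall i j, i != j -> ~ vmon_dvd (mu i) (mu j)
}.

(** A monomial lies in a module generated by monomials exactly when a generator divides it, which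
    turns equality of leading modules into [mlb_cover]. *)
Lemma minimal_groebner_basisP (M : 'rV[R]_m -> Prop) k (P : 'M[R]_(k, m))
    (mu : k.-tuple (vmon r m)) :
  minimal_groebner_basis le M P /\ lm_mx le P = map_tuple Some mu <->
  minimal_lm_basis M P (tnth mu).
Proof.
have rows_lm : (forall i, lm le (row i P) = Some (tnth mu i)) ->
    (fun v => exists i x, lm le (row i P) = Some x /\ v = vmon_vec x) =
    (fun v : 'rV[R]_m => exists2 i, True & v = vmon_vec (tnth mu i)).
  move=> Plm; apply/funext => v; apply/propext; split.
    by move=> [i [x [+ ->]]]; rewrite Plm => -[<-]; exists i.
  by move=> [i _ ->]; exists i, (tnth mu i).
split=> [[[[PM P0 Pgen] Pmin] Plm]|[PM Plm Pcover Pmin]].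
  have {}Plm i : lm le (row i P) = Some (tnth mu i).
    by have := congr1 (fun t => tnth t i) Plm; rewrite tnth_mktuple tnth_map.
  split=> // [p x Mp px|i j ij]; last exact: Pmin ij (Plm i) (Plm j).
  have /Pgen : lm_module le M (vmon_vec x) by move=> N _; apply; exists p, x.
  rewrite /lm_rows_module rows_lm // => /vmon_vec_generated[i _].
  by exists i.
split; last by apply: eq_from_tnth => i; rewrite tnth_mktuple tnth_map.
split; last by move=> i j x y ij; rewrite !Plm => -[<-] [<-]; apply: Pmin.
split=> // [i|v]; first exact: lm_neq0 (Plm i).
split=> gen N Nsub NS; apply: gen => // s.
  move=> [p [x [Mp px ->]]]; have [i [nu <-]] := Pcover p x Mp px.
  by case: Nsub => _ _ NZ; rewrite vmon_vec_mul; apply/NZ/NS; exists i, (tnth mu i).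
by move=> [i [x [ix ->]]]; apply: NS; exists (row i P), x.
Qed.

Lemma sub_submodule (M : 'rV[R]_m -> Prop) p q : submodule M -> M (p + q) -> M q -> M p.
Proof.
case=> _ MD MZ Mpq /(MZ (-1)) Mq; have := MD _ _ Mpq Mq.
by rewrite scaleN1r addrK.
Qed.

(* Division with remainder by [P] only involves the rows whose leading monomial
   is smaller than the bound [b] on the monomials of [q]. *)
Lemma mem_of_small_rows (M M' : 'rV[R]_m -> Prop) k (P : 'M[R]_(k, m))
    (mu : 'I_k -> vmon r m) b :
  submodule M -> submodule M' -> minimal_lm_basis M P mu ->
  (forall i, order_lt le (mu i) b -> M' (row i P)) ->
  forall q, M q -> {in vsupp q, forall x, order_lt le x b} -> M' q.
Proof.
move=> subM subM' [PM Plm Pcover _] small.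
have [_ MD MZ] := subM; have [M'0 M'D M'Z] := subM'.
(* Bounding the leading monomial suffices, and the well-founded induction descends on it. *)
suff main x : order_lt le x b -> forall q, M q -> lm le q = Some x -> M' q.
  move=> q Mq qb; have [-> //|/lm_exists[x qx]] := eqVneq q 0.
  by apply: (main x) => //; apply: qb; have /lmP[] := qx.
elim/(well_founded_ind (order_lt_wf leM)): x => x IH xb q Mq qx.
have [i [nu nuE]] := Pcover q x Mq qx.
have Mi : M' (row i P).
  apply: small; apply: (order_le_lt_trans leM) xb.
  by apply: (order_le_dvd leM); exists nu.
rewrite -nuE in qx; have [c] := lm_cancel qx (Plm i); rewrite nuE => cx.
(* The multiple of the row lies in [M'], so it is enough to treat the remainder [q'], which is zero
   or has a smaller leading monomial. *)
apply: (sub_submodule subM' _ (M'Z c%:MP _ (M'Z 'X_[nu] _ Mi))).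
set q' := q + _ in cx *; have Mq' : M q' by apply/MD/MZ/MZ.
have [-> //|/lm_exists[y q'y]] := eqVneq q' 0.
have yx : order_lt le y x by apply: cx; have /lmP[] := q'y.
exact: IH (order_lt_trans leM yx xb) _ Mq' q'y.
Qed.

End Order.

(** * From an output list to a minimal basis *)

Section Correctness.
Context {m : nat} (le : rel (vmon r m)) (leM : monomial_order le).

(** Rows are addressed by labels in [I] rather than by positions, so that verifying the output
    becomes a case analysis on the kind of row. *)
Lemma syz_out_of_seq_basis (M : 'rV[R]_m -> Prop) k (P : 'M[R]_(k, m))
    (I : eqType) (t : seq I) (f : I -> 'rV[R]_k * vmon r m) :
  uniq t ->
  {in t, forall a, M ((f a).1 *m P)} ->
  {in t, forall a, lm le ((f a).1 *m P) = Some (f a).2} ->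
  (forall p x, M p -> lm le p = Some x -> exists2 a, a \in t & vmon_dvd (f a).2 x) ->
  {in t &, forall a b, a != b -> ~ vmon_dvd (f a).2 (f b).2} ->
  let out := syz_out_of_seq [seq f a | a <- t] in
  minimal_lm_basis le M (syz_mat out *m P) (tnth (syz_lms out)).
Proof.
move=> t_uniq fM f_lm f_cover f_ndvd out.
(* The label of the row at position [i]; uniqueness of [t] makes it injective. *)
pose idx (i : 'I_(syz_size out)) := tnth (in_tuple t) (cast_ord (size_map f t) i).
have idx_mem i : idx i \in t := mem_tnth _ _.
have idx_inj : injective idx.
  by move=> i j /(tuple_uniqP (in_tuple t) t_uniq)/cast_ord_inj.
have tnthE (i : 'I_(syz_size out)) : tnth (in_tuple [seq f a | a <- t]) i = f (idx i).
  rewrite (tnth_nth (f (idx i))) /= (nth_map (idx i)); last first.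
    by rewrite -(size_map f t).
  by rewrite [in RHS]/idx (tnth_nth (idx i)).
have rowE i : row i (syz_mat out *m P) = (f (idx i)).1 *m P.
  by rewrite row_mul rowK tnthE.
have lmsE i : tnth (syz_lms out) i = (f (idx i)).2 by rewrite tnth_map tnthE.
split=> [i|i|p x Mp px|i j ij].
- by rewrite rowE; apply: fM.
- by rewrite rowE lmsE; apply: f_lm.
- have [a ta ax] := f_cover p x Mp px.
  have ltk : (index a t < syz_size out)%N by rewrite /= size_map index_mem.
  exists (Ordinal ltk); rewrite lmsE /idx (tnth_nth a) /= nth_index //.
by rewrite !lmsE; apply: f_ndvd; rewrite ?idx_mem // (inj_eq idx_inj).
Qed.

Lemma syz_submodule n (N : 'rV[R]_n -> Prop) (F : 'M[R]_(m, n)) :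
  submodule N -> submodule (syz N F).
Proof.
move=> [N0 ND NZ]; rewrite /syz; split=> [|u v|a v]; first by rewrite mul0mx.
  by rewrite mulmxDl; apply: ND.
by rewrite -scalemxAl; apply: NZ.
Qed.

(** * The base case: a single functional *)

Section BaseCase.
Context {n : nat} (phi : 'rV[R]_n -> K) (phi_lin : functional_linear phi).

Lemma functional_linear0 : phi 0 = 0.
Proof.
have := phi_lin 1 0 0; rewrite scaler0 addr0 mul1r => /eqP.
by rewrite -subr_eq subrr => /eqP <-.
Qed.

Lemma functional_linearD u v : phi (u + v) = phi u + phi v.
Proof. by have := phi_lin 1 u v; rewrite mpolyC1 scale1r mul1r. Qed.

Lemma functional_linearZ c u : phi (c%:MP *: u) = c * phi u.
Proof. by have := phi_lin c u 0; rewrite functional_linear0 !addr0. Qed.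

(** As [phi] is only [K]-linear, the submodule hypothesis on its kernel within [N] supplies closure
    under multiplication by monomials, used when dividing by rows on which [phi] vanishes. *)
Lemma syzygy_basecase_correct (N : 'rV[R]_n -> Prop) (F : 'M[R]_(m, n)) k
    (P : 'M[R]_(k, m)) (mu : k.-tuple (vmon r m)) :
  submodule N -> submodule (fun p => phi p = 0 /\ N p) ->
  minimal_lm_basis le (syz N F) P (tnth mu) ->
  let out := syzygy_basecase le phi (P *m F) mu in
  minimal_lm_basis le (syz (fun p => phi p = 0 /\ N p) F) (syz_mat out *m P)
    (tnth (syz_lms out)).
Proof.
move=> subN subN' GB; have [PM Plm Pcover Pndvd] := GB.
rewrite /syzygy_basecase; case: pickP => [i0 vi0|v0]; last first.
  rewrite /= mul1mx; split=> // [i|p x [_ Mp]]; last exact: Pcover Mp.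
  split; last exact: PM.
  by rewrite -row_mul; apply/eqP; have := v0 i => /= /negbFE.
case: (@extremumP _ _ (induced_le le mu) i0 _ (fun i => (0%MM, i))) => //.
- by move=> x; rewrite /induced_le eqxx.
- exact: induced_le_trans.
- exact: induced_le_total.
move=> piv vpiv pivmin; cbv zeta.
set shift := fun j : 'I_r => vmon_mul U_(j)%MM (tnth mu piv).
set js := [seq _ <- enum 'I_r | _]; set reduced := fun i : 'I_k => (_ + _, _).
set shifted := fun j : 'I_r => (_, shift j).
pose v i := phi (row i (P *m F)); rewrite -/(v piv) in vpiv.
set M := syz N F in PM Pcover GB; set M' := syz _ F.
have subM : submodule M := syz_submodule F subN.
have subM' : submodule M' := syz_submodule F subN'.
have vE i : v i = phi (row i P *m F) by rewrite /v row_mul.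
(* Equal leading monomials would violate minimality of [P], so the pivot's one is strictly
   smallest. *)
have pivlt i : v i != 0 -> i != piv -> order_lt le (tnth mu piv) (tnth mu i).
  move=> vi ip; have /orP[|/orP[]] := pivmin i vi.
  - by rewrite xpair_eqE eqxx eq_sym (negbTE ip).
  - by rewrite !vmon_mul0.
  rewrite !vmon_mul0 => /andP[/eqP e _]; case: (Pndvd _ _ ip).
  by rewrite /= e; apply: vmon_dvd_refl.
have small i : order_lt le (tnth mu i) (tnth mu piv) -> M' (row i P).
  move=> lti; split; last exact: PM.
  rewrite -vE; apply: contraTeq lti => vi; rewrite order_ltN // negbK.
  have [->|/(pivlt i vi)/order_ltW//] := eqVneq i piv.
  by rewrite (monomial_order_refl leM).
have shift_gt j : order_lt le (tnth mu piv) (shift j).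
  apply/andP; split; last by apply: order_le_dvd => //; exists U_(j)%MM.
  apply/eqP; rewrite -[LHS]vmon_mul0 => /vmon_mul_injl/esym/eqP.
  by rewrite mnm1_eq0.
have js_dvd j : j \in js <-> ~ exists2 i, i != piv & vmon_dvd (tnth mu i) (shift j).
  rewrite mem_filter mem_enum andbT; split=> [/asboolPn + dv|ndv].
    by apply; apply/vmon_vec_generated.
  by apply/asboolPn => /vmon_vec_generated.
(* Labels: [inl i] for an old row corrected by the pivot row, [inr j] for the pivot row times [X_j]
   minus a constant; [t] lists them in output order. *)
pose f (a : 'I_k + 'I_r) := match a with inl i => reduced i | inr j => shifted j end.
pose t : seq ('I_k + 'I_r) :=
  [seq inl i | i : 'I_k <- enum 'I_k & (i < piv)%N] ++ [seq inr j | j <- js]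
    ++ [seq inl i | i : 'I_k <- enum 'I_k & (piv < i)%N].
have inl_inj : injective (@inl 'I_k 'I_r) by move=> ? ? [].
have inr_inj : injective (@inr 'I_k 'I_r) by move=> ? ? [].
have no_inl (s : seq 'I_r) i : (inl i \in [seq @inr 'I_k 'I_r j | j <- s]) = false.
  by apply/mapP => -[].
have no_inr (s : seq 'I_k) j : (inr j \in [seq @inl 'I_k 'I_r i | i <- s]) = false.
  by apply/mapP => -[].
have t_inl i : (inl i \in t) = (i != piv).
  rewrite !mem_cat no_inl !(mem_map inl_inj) !(mem_enum, mem_filter) !andbT /=.
  by rewrite -neq_ltn.
have t_inr j : (inr j \in t) = (j \in js).
  by rewrite !mem_cat !no_inr (mem_map inr_inj) orbF.
have t_uniq : uniq t.
  rewrite !cat_uniq !(map_inj_uniq inl_inj) (map_inj_uniq inr_inj).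
  rewrite !(filter_uniq _ (enum_uniq _)) /= andbT.
  apply/andP; split; apply/hasPn => -[i|j]; rewrite ?no_inl ?no_inr //.
  rewrite mem_cat no_inl !(mem_map inl_inj) !mem_filter /= => /andP[pi _].
  by rewrite ltnNge ltnW.
have -> : [seq reduced i | i : 'I_k <- enum 'I_k & (i < piv)%N] ++
    [seq shifted j | j <- js] ++ [seq reduced i | i : 'I_k <- enum 'I_k & (piv < i)%N] =
    [seq f a | a <- t].
  by rewrite !map_cat -!map_comp.
have reducedE i : (reduced i).1 *m P = row i P + (- v i / v piv)%:MP *: row piv P.
  by rewrite /= mulmxDl -scalemxAl -!rowE.
have shiftedE j : (shifted j).1 *m P =
    'X_j *: row piv P + (- (phi ('X_j *: row piv (P *m F)) / v piv))%:MP *: row piv P.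
  by rewrite /= -scalemxAl -rowE scalerBl mpolyCN scaleNr.
apply: syz_out_of_seq_basis => //.
- move=> [i|j] _ /=.
    rewrite reducedE; split; last by case: subM => _ MD MZ; apply/MD/MZ.
    rewrite mulmxDl -scalemxAl functional_linearD functional_linearZ -!vE.
    by rewrite mulNr mulNr divfK // subrr.
  rewrite shiftedE; split; last by case: subM => _ MD MZ; apply/MD/MZ => //; apply: MZ.
  rewrite mulmxDl -!scalemxAl functional_linearD functional_linearZ -vE.
  by rewrite row_mul mulNr divfK // subrr.
(* Neither correction reaches the leading monomial: that of the pivot row is below [tnth mu i]
   whenever [v i] is nonzero, and always below [shift j]. *)
- move=> [i|j]; rewrite ?t_inl => ta /=.
    rewrite reducedE; apply: lm_addl => // x.
    have [->|vi] := eqVneq (v i) 0.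
      by rewrite oppr0 mul0r mpolyC0 scale0r mem_vsupp /vcoef mxE mcoeff0 eqxx.
    move=> /vsuppCZ; have /(lmP leM)[_ /[apply] xle] := Plm piv.
    exact: order_le_lt_trans leM _ _ _ xle (pivlt i vi ta).
  rewrite shiftedE; apply: (lm_addl leM); first exact: (lmXZ leM).
  move=> x /vsuppCZ; have /(lmP leM)[_ /[apply] xle] := Plm piv.
  exact: order_le_lt_trans leM _ _ _ xle (shift_gt j).
- move=> p x [phip Mp] px; have [i] := Pcover p x Mp px.
  have [->|ip ix] := eqVneq i piv; last by exists (inl i); rewrite ?t_inl.
  move=> [nu nux]; have [nu0|] := eqVneq nu 0%MM.
    (* Here [x = tnth mu piv]. The combination [q] has only smaller monomials, so it lies in [M'];
       then [c * v piv = 0] gives [c = 0], and [q = p] would lack its own leading monomial. *)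
    exfalso; have px' := px; rewrite -nux in px'.
    have [c] := lm_cancel leM px' (Plm piv); set q := p + _ => qlt.
    have Mq : M q by case: subM => _ MD MZ; apply/MD/MZ/MZ.
    have [] : M' q.
      apply: (mem_of_small_rows leM subM subM' GB small) => // y /qlt.
      by rewrite nu0 vmon_mul0.
    rewrite /q nu0 mpolyX0 scale1r mulmxDl -scalemxAl functional_linearD phip add0r.
    rewrite functional_linearZ -vE => /eqP.
    rewrite mulf_eq0 (negbTE vpiv) orbF => /eqP c0 _.
    have /(lmP leM)[+ _] := px; rewrite -nux; move: qlt.
    rewrite /q c0 mpolyC0 scale0r addr0 => qlt /qlt.
    by rewrite /order_lt eqxx.
  (* Otherwise some [X_j] divides the cofactor [nu], so [shift j] divides [x]; if [j] was discarded,
     another [tnth mu i'] divides [shift j]. *)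
  move=> nu0; have [j nuj] : exists j, nu j != 0%N.
    apply: contrapT => nex; case/eqP: nu0; apply/mnmP => j; rewrite mnm0E.
    by apply: contrapT => nuj; apply: nex; exists j; apply/eqP.
  have shiftx : vmon_dvd (shift j) x.
    exists (nu - U_(j))%MM; rewrite /shift vmon_mulA submK //.
    by apply/mnm_lepP => i'; rewrite mnm1E; case: eqP => // <-; rewrite lt0n.
  have [tj|/negP/js_dvd/contrapT[i' i'p i'x]] := boolP (j \in js).
    by exists (inr j); rewrite ?t_inr.
  by exists (inl i'); rewrite ?t_inl //; apply: vmon_dvd_trans i'x shiftx.
(* Two old rows: minimality of [P]. Old against shifted: the selection of [js]. Shifted against old:
   the pivot monomial would divide that of another row. *)
move=> [i|j] [i'|j']; rewrite ?t_inl ?t_inr => ta tb ab /=.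
- by apply: Pndvd; apply: contraNneq ab => ->.
- by move=> dv; move/js_dvd: tb; apply; exists i.
- move=> dv; apply: (Pndvd piv i'); first by rewrite eq_sym.
  by apply: vmon_dvd_trans dv; exists U_(j)%MM.
(* Comparing exponents of [X_j] in [nu + U_(j) = U_(j')] forces [j = j']. *)
move=> [nu]; rewrite vmon_mulA => /vmon_mul_injl/mnmP/(_ j).
rewrite mnmDE !mnm1E eqxx; case: eqP => [e|]; last by lia.
by case/eqP: ab; rewrite e.
Qed.

End BaseCase.

(** * Divide and conquer over a list of functionals *)

Definition zeros n (phis : seq ('rV[R]_n -> K)) (p : 'rV[R]_n) : bool :=
  all (fun phi => phi p == 0) phis.

(** [N] and [P] vary in the induction: the second call works with [N] cut down by the first kernels
    and with the basis from the first call. All prefixes, the empty one included, must give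
    submodules so that this hypothesis passes to both halves. *)
Lemma syzygy_dac_correct n (F : 'M[R]_(m, n)) (phis : seq ('rV[R]_n -> K))
    (N : 'rV[R]_n -> Prop) k (P : 'M[R]_(k, m)) (mu : k.-tuple (vmon r m)) :
  (0 < size phis)%N ->
  all (fun phi => `[< functional_linear phi >]) phis ->
  (forall i, submodule (fun p => zeros (take i phis) p /\ N p)) ->
  minimal_lm_basis le (syz N F) P (tnth mu) ->
  let out := syzygy_dac le phis (P *m F) mu in
  minimal_lm_basis le (syz (fun p => zeros phis p /\ N p) F) (syz_mat out *m P)
    (tnth (syz_lms out)).
Proof.
have [d] := ubnP (size phis); elim: d => // d IH in phis N k P mu *.
rewrite ltnS => phis_d phis0 lin subN GB.
have [size_le1|size_gt1] := leqP (size phis) 1.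
  case: phis phis0 size_le1 lin subN {phis_d} => [|phi [|//]] //= _ _.
  move=> /andP[/asboolP lin _] subN.
  have zE : (fun p => zeros [:: phi] p /\ N p) = (fun p => phi p = 0 /\ N p).
    apply/funext => p; apply/propext; rewrite /zeros /= andbT.
    by split=> -[/eqP].
  have N0E : (fun p => zeros (take 0 [:: phi]) p /\ N p) = N.
    by apply/funext => p; apply/propext; split=> [[]|].
  rewrite syzygy_dac1 zE; apply: syzygy_basecase_correct => //.
    by rewrite -N0E; apply: subN.
  by rewrite -zE; apply: (subN 1%N).
rewrite syzygy_dacE //; set h := (size phis)./2; cbv zeta.
move: lin; rewrite -{1}(cat_take_drop h phis) all_cat => /andP[lin1 lin2].
(* With at least two functionals both halves are nonempty and strictly shorter. *)
have h_gt0 : (0 < h)%N by rewrite /h; lia.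
have h_lt : (h < size phis)%N by rewrite /h; lia.
have take_size : size (take h phis) = h by rewrite size_take h_lt.
set o1 := syzygy_dac le (take h phis) _ _.
have GB1 : minimal_lm_basis le (syz (fun p => zeros (take h phis) p /\ N p) F)
    (syz_mat o1 *m P) (tnth (syz_lms o1)).
  apply: IH; rewrite ?take_size ?(leq_trans h_lt) // => i.
  by rewrite -take_min; apply: subN.
(* A prefix of the second half, joined to the first half, is a prefix of the whole list. *)
have zE i : (fun p => zeros (take i (drop h phis)) p /\ zeros (take h phis) p /\ N p) =
    (fun p => zeros (take (h + i) phis) p /\ N p).
  apply/funext => p; apply/propext; rewrite takeD /zeros all_cat.
  by split=> [[-> [->]]|[/andP[-> ->]]].
have := zE (size phis); rewrite (take_oversize (leq_addl _ _)).
rewrite take_oversize ?size_drop ?leq_subr // => <-.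
rewrite mulmxA; set o2 := syzygy_dac le (drop h phis) _ _; rewrite /= -mulmxA.
apply: (IH _ _ _ _ _ _ _ _ _ GB1) => //; rewrite ?size_drop; [lia|lia|].
by move=> i; rewrite zE; apply: subN.
Qed.

End Correctness.
End LeadingMonomials.

Theorem theorem4p3 (K : fieldType) (r m n k D : nat)
    (N : 'rV[{mpoly K[r]}]_n -> Prop) (F : 'M[{mpoly K[r]}]_(m, n))
    (le : rel (vmon r m)) (P : 'M[{mpoly K[r]}]_(k, m))
    (phi : D.-tuple ('rV[{mpoly K[r]}]_n -> K)) (mu : k.-tuple (vmon r m)) :
  submodule N ->
  monomial_order le ->
  minimal_groebner_basis le (syz N F) P ->
  (1 <= D)%N ->
  (forall j : 'I_D, functional_linear (tnth phi j)) ->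
  (forall i : nat, (1 <= i <= D)%N -> submodule (fun p => ker_cap phi i p /\ N p)) ->
  lm_mx le P = map_tuple Some mu ->
  let out := syzygy_dac le phi (P *m F) mu in
  let QP := syz_mat out *m P in
  minimal_groebner_basis le (syz (fun p => ker_cap phi D p /\ N p) F) QP /\
  lm_mx le QP = map_tuple Some (syz_lms out).
Proof.
move=> subN leM PGB D_gt0 phi_lin subNi Plm out QP.
have kerE i : (i <= D)%N ->
    (fun p => ker_cap phi i p /\ N p) = (fun p => zeros (take i phi) p /\ N p).
  move=> iD; apply/funext => p; apply/propext.
  suff kerP : ker_cap phi i p <-> zeros (take i phi) p by rewrite kerP.
  split=> [kerp|/(all_nthP (fun _ => 0)) zp j ji].
    apply/(all_nthP (fun _ => 0)) => j; rewrite size_takel ?size_tuple // => ji.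
    rewrite nth_take //; have jD := leq_trans ji iD.
    by rewrite -[j]/(val (Ordinal jD)) -tnth_nth kerp.
  rewrite (tnth_nth (fun _ => 0)) -(nth_take _ ji); apply/eqP/zp.
  by rewrite size_takel ?size_tuple.
apply/minimal_groebner_basisP => //; rewrite kerE // take_oversize ?size_tuple //.
apply: syzygy_dac_correct => //.
- by rewrite size_tuple.
- by apply/all_tnthP => j; apply/asboolP.
(* The empty prefix gives [N] itself, and prefixes longer than [D] are the whole list. *)
- move=> i; have [->|i_gt0] := posnP i.
    rewrite take0 (_ : (fun p => _) = N) //.
    by apply/funext => p; apply/propext; split=> [[]|].
  have [iD|/ltnW Di] := leqP i D; first by rewrite -kerE //; apply/subNi/andP.
  rewrite take_oversize ?size_tuple // -[X in zeros X](take_oversize (leqnn (size phi))).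
  by rewrite size_tuple -kerE //; apply: subNi; rewrite D_gt0 leqnn.
by apply/minimal_groebner_basisP.
Qed.
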